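(* Every Boolean control network that is Type-4 observable is also Type-3 observable. The converse is not true: there exists a Boolean control network that is Type-3 observable but not Type-4 observable.
   Context: A Boolean control network (BCN, in algebraic form) is given by positive integers $n,m,q$, with $N=2^n$, $M=2^m$, $Q=2^q$, and a system $x(t+1)=Lu(t)x(t)$, $y(t)=Hx(t)$, $t=0,1,2,\dots$, with states $x(t)\in\Delta_N$, inputs $u(t)\in\Delta_M$, outputs $y(t)\in\Delta_Q$. Here $\Delta_k$ is the set of columns of the identity matrix $I_k$; $L$ is an $N\times NM$ matrix with all columns in $\Delta_N$ and $H$ is a $Q\times N$ matrix with all columns in $\Delta_Q$. Products are semi-tensor products; concretely $Lux=L(u\otimes x)$ for $u\in\Delta_M$, $x\in\Delta_N$, with $\otimes$ the Kronecker product. For $x_0\in\Delta_N$, $p\ge 1$ and $U=u_0\cdots u_{p-1}\in(\Delta_M)^p$, put $x_{t+1}=Lu_tx_t$ for $0\le t<p$ and $(HL)_{x_0}^p(U)=(Hx_1)\cdots(Hx_p)\in(\Delta_Q)^p$. For an infinite input sequence $U=u_0u_1\cdots\in(\Delta_M)^{\mathbb{N}}$, put likewise $(HL)_{x_0}^{\mathbb{N}}(U)=(Hx_1)(Hx_2)\cdots\in(\Delta_Q)^{\mathbb{N}}$ with $x_{t+1}=Lu_tx_t$ for all $t\ge 0$. Type-3 observability: there exist $p\ge1$ and $U\in(\Delta_M)^p$ such that for any distinct $x_0,\bar x_0\in\Delta_N$, $Hx_0=H\bar x_0$ implies $(HL)_{x_0}^p(U)\neq(HL)_{\bar x_0}^p(U)$.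 Type-4 observability: for any distinct $x_0,\bar x_0\in\Delta_N$ and any $U\in(\Delta_M)^{\mathbb{N}}$, $Hx_0=H\bar x_0$ implies $(HL)_{x_0}^{\mathbb{N}}(U)\neq(HL)_{\bar x_0}^{\mathbb{N}}(U)$. *)

(* Defs.v *)
From mathcomp Require Import all_boot all_order all_algebra mxtens.

Set Implicit Arguments.
Unset Strict Implicit.
Unset Printing Implicit Defensive.

Local Open Scope ring_scope.

(* The matrices involved are 0-1 matrices; the entries are taken in int. *)
Definition Delta (k : nat) : {pred 'cV[int]_k} :=
  fun x => [exists i, x == col i 1%:M].

Arguments Delta k : clear implicits.

(* The columns of L are indexed by 2 ^ m * 2 ^ n (input index first), the row
   index set of the Kronecker product u *t x. *)
Record BCN := MkBCN {
  bcn_n : nat;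
  bcn_m : nat;
  bcn_q : nat;
  bcn_n_gt0 : (0 < bcn_n)%N;
  bcn_m_gt0 : (0 < bcn_m)%N;
  bcn_q_gt0 : (0 < bcn_q)%N;
  bcn_L : 'M[int]_(2 ^ bcn_n, 2 ^ bcn_m * 2 ^ bcn_n);
  bcn_H : 'M[int]_(2 ^ bcn_q, 2 ^ bcn_n);
  bcn_L_col : forall j, col j bcn_L \in Delta (2 ^ bcn_n);
  bcn_H_col : forall j, col j bcn_H \in Delta (2 ^ bcn_q)
}.

Notation bcn_N B := (2 ^ bcn_n B)%N.
Notation bcn_M B := (2 ^ bcn_m B)%N.
Notation bcn_Q B := (2 ^ bcn_q B)%N.

(* tensmx u x has 1 * 1 columns, which is convertible to 1. *)
Definition bcn_step (B : BCN) (x : 'cV[int]_(bcn_N B))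
    (u : 'cV[int]_(bcn_M B)) : 'cV[int]_(bcn_N B) :=
  bcn_L B *m tensmx u x.

Definition bcn_out (B : BCN) (x : 'cV[int]_(bcn_N B)) : 'cV[int]_(bcn_Q B) :=
  bcn_H B *m x.

(* scanl omits its starting point: for U = u_0 ... u_(p-1) this is the word
   (H x_1) ... (H x_p), without H x_0. *)
Definition HL_fin (B : BCN) (x0 : 'cV[int]_(bcn_N B)) (p : nat)
    (U : p.-tuple 'cV[int]_(bcn_M B)) : p.-tuple 'cV[int]_(bcn_Q B) :=
  [tuple of [seq bcn_out x | x <- scanl (@bcn_step B) x0 U]].

Fixpoint bcn_state (B : BCN) (x0 : 'cV[int]_(bcn_N B))
    (U : nat -> 'cV[int]_(bcn_M B)) (t : nat) : 'cV[int]_(bcn_N B) :=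
  if t is t'.+1 then bcn_step (bcn_state x0 U t') (U t') else x0.

(* As in the finite case, the output sequence starts with H x_1. *)
Definition HL_inf (B : BCN) (x0 : 'cV[int]_(bcn_N B))
    (U : nat -> 'cV[int]_(bcn_M B)) : nat -> 'cV[int]_(bcn_Q B) :=
  fun t => bcn_out (bcn_state x0 U t.+1).

Definition type3_observable (B : BCN) : Prop :=
  exists (p : nat) (U : p.-tuple 'cV[int]_(bcn_M B)),
    [/\ (0 < p)%N,
        forall t, tnth U t \in Delta (bcn_M B)
      & forall x0 x0' : 'cV[int]_(bcn_N B),
          x0 \in Delta (bcn_N B) -> x0' \in Delta (bcn_N B) -> x0 <> x0' ->
          bcn_out x0 = bcn_out x0' -> HL_fin x0 U <> HL_fin x0' U].

Definition type4_observable (B : BCN) : Prop :=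
  forall x0 x0' : 'cV[int]_(bcn_N B),
    x0 \in Delta (bcn_N B) -> x0' \in Delta (bcn_N B) -> x0 <> x0' ->
    forall U : nat -> 'cV[int]_(bcn_M B),
      (forall t, U t \in Delta (bcn_M B)) ->
      bcn_out x0 = bcn_out x0' -> HL_inf x0 U <> HL_inf x0' U.

(* Main.v *)
Require Import Defs.
From mathcomp Require Import all_boot all_order all_algebra mxtens.
From Stdlib Require Import FunctionalExtensionality.

Set Implicit Arguments.
Unset Strict Implicit.
Unset Printing Implicit Defensive.

Import GRing.Theory.
Local Open Scope ring_scope.

(** Under Type-4 observability every input sequence, in particular a constant
    one, separates any two distinct states [x0], [x0'] with equal present
    outputs.  A constant input turns the network into an autonomous system on
    [N] states, and two copies of it run in parallel form an autonomous system
    on the [N * N] pairs of states.  The trajectory of a pair visits all the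
    pairs it will ever visit within the times [0, ..., N * N - 1]
    ([iter_bounded]), so if the outputs of the two copies agree at these times
    then they agree forever.  Hence the constant input word of length [N * N]
    already separates all the pairs that have to be separated, which is Type-3
    observability.

    For the failure of the converse, let the state be two bits, of which the
    high one is the output.  One input copies the hidden low bit to the visible
    one, the other resets the state to zero.  The first input reveals the whole
    state after one step, and the constant use of the second one never reveals
    the low bit. *)

(** * Dynamics on indices *)

Lemma DeltaP k (x : 'cV[int]_k) :
  reflect (exists i, x = delta_mx i 0) (x \in Delta k).
Proof.
apply: (iffP existsP) => [[i /eqP->]|[i ->]]; exists i.
  by rewrite colE mul1mx.
by rewrite colE mul1mx.
Qed.

Lemma delta_Delta k (i : 'I_k) : delta_mx i 0 \in Delta k.
Proof. by apply/DeltaP; exists i. Qed.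

Lemma delta_cV_inj k : injective (fun i : 'I_k => delta_mx i 0 : 'cV[int]_k).
Proof.
move=> i j /= /matrixP/(_ i 0); rewrite !mxE !eqxx andbT /=.
by case: (i =P j).
Qed.

Lemma tensmx_delta M N (u : 'I_M) (x : 'I_N) :
  tensmx (delta_mx u 0 : 'cV[int]_M) (delta_mx x 0 : 'cV[int]_N) =
  delta_mx (mxtens_index (u, x)) 0 :> 'cV[int]_(M * N).
Proof.
apply/matrixP=> r c; case: (mxtens_indexP r) => i j.
case: (mxtens_indexP (c : 'I_(1 * 1))) => k l; rewrite [LHS]tensmxE !mxE !ord1 !eqxx !andbT.
rewrite (can_eq (@mxtens_indexK M N)) xpair_eqE.
by case: (i == u); case: (j == x).
Qed.

Lemma bcn_step_delta (B : BCN) (u : 'I_(bcn_M B)) (x : 'I_(bcn_N B)) :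
  bcn_step (delta_mx x 0) (delta_mx u 0) = col (mxtens_index (u, x)) (bcn_L B).
Proof. by rewrite /bcn_step tensmx_delta colE. Qed.

Lemma bcn_step_index (B : BCN) (u : 'cV[int]_(bcn_M B)) :
  u \in Delta (bcn_M B) ->
  exists f : 'I_(bcn_N B) -> 'I_(bcn_N B),
    forall i, bcn_step (delta_mx i 0) u = delta_mx (f i) 0.
Proof.
case/DeltaP=> k ->.
apply: (fin_all_exists
  (P := fun i j => bcn_step (delta_mx i 0) (delta_mx k 0) = delta_mx j 0)) => i.
by rewrite bcn_step_delta; apply/DeltaP; apply: bcn_L_col.
Qed.

(** * Constant inputs *)

Lemma bcn_state_const (B : BCN) (x : 'cV[int]_(bcn_N B)) u t :
  bcn_state x (fun=> u) t = iter t (fun y => bcn_step y u) x.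
Proof. by elim: t => //= t ->. Qed.

Lemma tnth_HL_fin_const (B : BCN) (x : 'cV[int]_(bcn_N B)) u p (t : 'I_p) :
  tnth (HL_fin x [tuple of nseq p u]) t = HL_inf x (fun=> u) t.
Proof.
rewrite (tnth_nth 0) /= (nth_map 0) ?size_scanl ?size_nseq //.
rewrite nth_scanl ?size_nseq // take_nseq // /HL_inf bcn_state_const.
congr bcn_out; elim: t.+1 x => // k IHk x.
by rewrite iterSr -IHk.
Qed.

(** A trajectory meets all its points before its first repetition, and there
    are at most [#|T|] of them. *)
Lemma iter_bounded (T : finType) (f : T -> T) (P : T -> Prop) (x : T) :
  (forall t, (t < #|T|)%N -> P (iter t f x)) -> forall t, P (iter t f x).
Proof.
move=> Pf t; rewrite -(iter_findex (fconnect_iter f t x)).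
apply: Pf; apply: leq_trans (findex_max (fconnect_iter f t x)) _.
exact: max_card.
Qed.

(** The predicate to which [iter_bounded] applies is equality of the two
    outputs of a pair of states.  The output words start one step after the
    initial states, and [HL_fin] of length [p] shows the times [1, ..., p]:
    time [0] is supplied by the hypothesis on the initial outputs. *)
Lemma HL_fin_inf_const (B : BCN) (u x x' : 'cV[int]_(_)) :
  u \in Delta (bcn_M B) -> x \in Delta (bcn_N B) -> x' \in Delta (bcn_N B) ->
  bcn_out x = bcn_out x' ->
  HL_fin x [tuple of nseq (bcn_N B * bcn_N B) u] =
    HL_fin x' [tuple of nseq (bcn_N B * bcn_N B) u] ->
  HL_inf x (fun=> u) = HL_inf x' (fun=> u).
Proof.
case/bcn_step_index=> f fE /DeltaP[i ->] /DeltaP[i' ->] eq0 eqfin.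
have stE j t : bcn_state (delta_mx j 0) (fun=> u) t = delta_mx (iter t f j) 0.
  by elim: t => //= t ->; rewrite fE.
pose f2 (z : 'I_(bcn_N B) * 'I_(bcn_N B)) := (f z.1, f z.2).
have f2E t : iter t f2 (i, i') = (iter t f i, iter t f i').
  by elim: t => //= t ->.
pose same_out (z : 'I_(bcn_N B) * 'I_(bcn_N B)) :=
  @bcn_out B (delta_mx z.1 0) = bcn_out (delta_mx z.2 0).
have eq_all : forall t, same_out (iter t f2 (i, i')).
  apply: iter_bounded => -[//|t]; rewrite card_prod card_ord => /ltnW tp.
  have := congr1 (fun w => tnth w (Ordinal tp)) eqfin.
  by rewrite !tnth_HL_fin_const /HL_inf !stE /same_out f2E.
apply: functional_extensionality => t.
by have := eq_all t.+1; rewrite /HL_inf !stE /same_out f2E.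
Qed.

Lemma type4_type3 (B : BCN) : type4_observable B -> type3_observable B.
Proof.
move=> obs4.
have M_gt0 : (0 < bcn_M B)%N by rewrite expn_gt0.
pose u : 'cV[int]_(bcn_M B) := delta_mx (Ordinal M_gt0) 0.
have uD : u \in Delta (bcn_M B) by exact: delta_Delta.
exists (bcn_N B * bcn_N B)%N, [tuple of nseq (bcn_N B * bcn_N B) u]; split.
- by rewrite muln_gt0 !expn_gt0.
- by move=> t; rewrite tnth_nseq.
move=> x x' xD x'D neq eq0 eqfin.
exact: (obs4 x x' xD x'D neq (fun=> u) (fun=> uD) eq0)
  (HL_fin_inf_const uD xD x'D eq0 eqfin).
Qed.

(** * A network that is Type-3 but not Type-4 observable *)

Definition fun_mx M N (f : 'I_N -> 'I_M) : 'M[int]_(M, N) :=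
  \matrix_(i, j) (i == f j)%:R.

Lemma col_fun_mx M N (f : 'I_N -> 'I_M) j :
  col j (fun_mx f) = delta_mx (f j) 0.
Proof. by apply/colP=> i; rewrite !mxE eqxx andbT. Qed.

Lemma fun_mx_Delta M N (f : 'I_N -> 'I_M) j : col j (fun_mx f) \in Delta M.
Proof. by rewrite col_fun_mx delta_Delta. Qed.

Lemma copy_lt (u : 'I_(2 ^ 1)) (x : 'I_(2 ^ 2)) :
  ((u == 0 :> nat) * odd x * 2 < 2 ^ 2)%N.
Proof. by case: (u == 0 :> nat); case: (odd x). Qed.

Lemma high_lt (x : 'I_(2 ^ 2)) : (x %/ 2 < 2 ^ 1)%N.
Proof. by rewrite ltn_divLR. Qed.

(** States are two-bit numbers.  Input [0] moves the low bit to the high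
    position, input [1] resets the state. *)
Definition copy_reset (u : 'I_(2 ^ 1)) (x : 'I_(2 ^ 2)) := Ordinal (copy_lt u x).

Definition high_bit (x : 'I_(2 ^ 2)) := Ordinal (high_lt x).

Definition copy_reset_bcn : BCN :=
  @MkBCN 2 1 1 isT isT isT
    (fun_mx (fun k => let ux := mxtens_unindex k in copy_reset ux.1 ux.2))
    (fun_mx high_bit) (fun_mx_Delta _) (fun_mx_Delta _).

Lemma copy_reset_step u x :
  @bcn_step copy_reset_bcn (delta_mx x 0) (delta_mx u 0) =
  delta_mx (copy_reset u x) 0.
Proof.
by rewrite (@bcn_step_delta copy_reset_bcn) [LHS]col_fun_mx mxtens_indexK.
Qed.

Lemma copy_reset_out x :
  @bcn_out copy_reset_bcn (delta_mx x 0) = delta_mx (high_bit x) 0.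
Proof. by rewrite /bcn_out -colE col_fun_mx. Qed.

Lemma copy_reset_type3 : type3_observable copy_reset_bcn.
Proof.
pose u : 'I_(2 ^ 1) := @Ordinal (2 ^ 1) 0 isT.
exists 1%N, [tuple delta_mx u 0]; split=> //.
  by move=> t; rewrite (tnth_nth 0) ord1 /=; exact: delta_Delta.
move=> _ _ /DeltaP[x ->] /DeltaP[x' ->] neq; rewrite !copy_reset_out.
move=> /delta_cV_inj/(congr1 val)/= eq_high /(congr1 val)/=.
rewrite !copy_reset_step !copy_reset_out => -[/delta_cV_inj/(congr1 val)/=].
rewrite !mul1n !mulnK // => eq_low; case: neq; congr delta_mx; apply: val_inj.
rewrite /= (divn_eq x 2) (divn_eq x' 2) eq_high !modn2.
by case: (odd x) (odd x') eq_low => -[].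
Qed.

Lemma copy_reset_not_type4 : ~ type4_observable copy_reset_bcn.
Proof.
pose u : 'I_(2 ^ 1) := @Ordinal (2 ^ 1) 1 isT.
pose x : 'I_(2 ^ 2) := @Ordinal (2 ^ 2) 0 isT.
pose x' : 'I_(2 ^ 2) := @Ordinal (2 ^ 2) 1 isT.
have state_reset y t :
    @bcn_state copy_reset_bcn (delta_mx y 0) (fun=> delta_mx u 0) t.+1 =
    delta_mx x 0.
  have resetE z : copy_reset u z = x by apply: val_inj.
  elim: t => [|t IHt]; first by rewrite /= copy_reset_step resetE.
  by rewrite [LHS]/= -/(bcn_state _ _ t.+1) IHt copy_reset_step resetE.
move=> /(_ (delta_mx x 0) (delta_mx x' 0) (delta_Delta _) (delta_Delta _)).
apply: (_ : ~ _) => obs4; apply: (obs4 _ (fun=> delta_mx u 0)).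
- by move=> /delta_cV_inj/(congr1 val).
- by move=> _; exact: delta_Delta.
- by rewrite !copy_reset_out; congr delta_mx; apply: val_inj.
by apply: functional_extensionality => t; rewrite /HL_inf !state_reset.
Qed.

Theorem mainTheorem11 :
  (forall B : BCN, type4_observable B -> type3_observable B) /\
  (exists B : BCN, type3_observable B /\ ~ type4_observable B).
Proof.
split; first exact: type4_type3.
by exists copy_reset_bcn; split;
  [exact: copy_reset_type3 | exact: copy_reset_not_type4].
Qed.
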